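(* Let $G$ be an abelian group with finite exponent, let $G_0 \subset G$ be a finite non-empty subset, and let $H$ be a transfer Krull monoid over $G_0$. The following are equivalent: (a) $H$ is half-factorial. (b) $\mathsf{hf}(H) = 1$. (c) $G_0$ is half-factorial (i.e. the monoid $\mathcal B(G_0)$ is half-factorial). (d) $\bigl|\mathsf L\bigl(\prod_{g\in G_0} g^{2\operatorname{ord}(g)}\bigr)\bigr| = 1$, where $\prod_{g\in G_0} g^{2\operatorname{ord}(g)}$ is viewed as an element of $\mathcal B(G_0)$ and its set of lengths is taken in $\mathcal B(G_0)$.
   Context: Monoids. A monoid is an associative semigroup with identity, written multiplicatively; $H^\times$ is the group of units of $H$. $H$ is unit-cancellative if $au=a$ or $ua=a$ implies $u\in H^\times$; monoids here are assumed unit-cancellative. An atom is a non-unit $u\in H$ such that $u=ab$ implies $a\in H^\times$ or $b\in H^\times$; $\mathcal A(H)$ is the set of atoms. For a non-unit $a$, $\mathsf L(a)=\mathsf L_H(a)$ is the set of all $k\in\mathbb N=\{1,2,\dots\}$ such that $a$ is a product of $k$ atoms of $H$; for $a\in H^\times$ set $\mathsf L(a)=\{0\}$. $H$ is half-factorial if $|\mathsf L(a)|=1$ for all $a\in H$. For $a\in H$, $\llbracket a\rrbracket$ denotes the smallest divisor-closed submonoid of $H$ containing $a$ (when $H$ is commutative it is $\{b\in H : b \text{ divides some power of } a\}$). The half-factoriality index $\mathsf{hf}(H)$ is the infimum (with $\inf\emptyset=\infty$) of all $N\in\mathbb N$ with the property: if $a\in H$ and $|\mathsf L(a^N)|=1$,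 then $\llbracket a\rrbracket$ is half-factorial. Zero-sum sequences. For a non-empty subset $G_0$ of an additive abelian group $G$, $\mathcal F(G_0)$ is the free abelian monoid (written multiplicatively) with basis $G_0$; its elements are called sequences over $G_0$. For $S=g_1\cdots g_\ell\in\mathcal F(G_0)$, $\sigma(S)=g_1+\dots+g_\ell\in G$. $\mathcal B(G_0)=\{S\in\mathcal F(G_0):\sigma(S)=0\}$ is the monoid of zero-sum sequences over $G_0$; it is reduced (its only unit is the empty sequence). Transfer Krull monoids. $H$ is a transfer Krull monoid over $G_0$ if there is a weak transfer homomorphism $\theta\colon H\to\mathcal B(G_0)$, i.e. a monoid homomorphism that is surjective, satisfies $\theta^{-1}(\{1\})=H^\times$, and such that whenever $a\in H$, $n\in\mathbb N$ and $\theta(a)=v_1\cdots v_n$ with $v_1,\dots,v_n\in\mathcal A(\mathcal B(G_0))$, there exist $u_1,\dots,u_n\in\mathcal A(H)$ and a permutation $\tau$ of $\{1,\dots,n\}$ with $a=u_1\cdots u_n$ and $\theta(u_i)=v_{\tau(i)}$ for all $i$. *)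

(* Defs.v *)
From HB Require Import structures.
From mathcomp Require Import all_boot ssralg fingroup perm.
From mathcomp Require Import finmap multiset.
From mathcomp Require Import boolp classical_sets.

Set Implicit Arguments.
Unset Strict Implicit.
Unset Printing Implicit Defensive.

Import GRing.Theory.

Local Open Scope classical_set_scope.
Local Open Scope group_scope.

Section Factorizations.
Context (H : monoidType).
Implicit Types a b u : H.

Definition is_unit a := exists b, a * b = 1 /\ b * a = 1.

Definition unit_cancellative :=
  forall a u, a * u = a \/ u * a = a -> is_unit u.

Definition is_atom u :=
  ~ is_unit u /\ forall a b, u = a * b -> is_unit a \/ is_unit b.

Definition lengths a : set nat :=
  [set k | (is_unit a /\ k = 0%N) \/
           [/\ ~ is_unit a, (0 < k)%N &
               exists u : 'I_k -> H,
                 (forall i, is_atom (u i)) /\ a = \prod_(i < k) u i]].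

Definition unique_length a := exists k, lengths a = [set k].

Definition half_factorial := forall a, unique_length a.

Definition submonoid (S : set H) :=
  S 1 /\ forall a b, S a -> S b -> S (a * b).

(* [b] divides [a] when [a] lies in [H b H]. *)
Definition divisor_closed (S : set H) :=
  forall a b x y, S a -> a = x * b * y -> S b.

(* The smallest divisor-closed submonoid containing [a], as the intersection
   of all of them. *)
Definition divisor_closure a : {pred H} :=
  [pred b | `[< forall S : set H,
                submonoid S -> divisor_closed S -> S a -> S b >]].

Fact divisor_closure_closed a : umagma_closed (divisor_closure a).
Proof.
split=> [|b c]; first by apply/asboolP=> S [].
move=> /asboolP Sb /asboolP Sc; apply/asboolP=> S subS divS Sa.
by have [_] := subS; apply; [apply: Sb | apply: Sc].
Qed.

Definition divisor_closure_monoid a := {b : H | b \in divisor_closure a}.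
HB.instance Definition _ a := Choice.on (divisor_closure_monoid a).
HB.instance Definition _ a := SubType.on (divisor_closure_monoid a).
HB.instance Definition _ a :=
  SubChoice_isSubMonoid.Build H (mem (divisor_closure a))
    (divisor_closure_monoid a) (divisor_closure_closed a).

End Factorizations.

Arguments half_factorial : clear implicits.
Arguments unit_cancellative : clear implicits.

Definition hf_property (H : monoidType) (N : nat) := forall a : H,
  unique_length (a ^+ N) -> half_factorial (divisor_closure_monoid a).

(* [None] stands for infinity, the infimum of the empty set. *)
Definition hf (H : monoidType) : option nat :=
  if pselect (exists N, (0 < N)%N && `[< hf_property H N >]) is left exN
  then Some (ex_minn exN) else None.

Section ZeroSum.
Context (G : zmodType) (G0 : {fset G}).

(* F(G0): sequences over G0 are the finite multisets on G0. *)
Definition seq_over := multiset G0.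
HB.instance Definition _ := Choice.on seq_over.

HB.instance Definition _ :=
  isMonoid.Build seq_over (@msetDA G0) (@mset0D G0) (@msetD0 G0).

Definition sigma (S : seq_over) : G := (\sum_(g <- enum_mset S) val g)%R.

Definition zero_sum : {pred seq_over} := [pred S | sigma S == 0%R].

Fact sigma1 : sigma 1 = 0%R.
Proof. by rewrite /sigma enum_mset0 big_nil. Qed.

Fact sigmaM S T : sigma (S * T) = (sigma S + sigma T)%R.
Proof.
rewrite /sigma -big_cat; apply: perm_big; apply/allP => x _ /=.
by rewrite count_cat !count_mem_mset msetE2.
Qed.

Fact zero_sum_closed : umagma_closed zero_sum.
Proof.
split=> [|S T]; first by rewrite inE sigma1.
by rewrite !inE sigmaM => /eqP-> /eqP->; rewrite addr0.
Qed.

Definition zero_sum_monoid := {S : seq_over | S \in zero_sum}.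
HB.instance Definition _ := Choice.on zero_sum_monoid.
HB.instance Definition _ := SubType.on zero_sum_monoid.
HB.instance Definition _ :=
  SubChoice_isSubMonoid.Build seq_over (mem zero_sum) zero_sum_monoid
    zero_sum_closed.

End ZeroSum.

Section Order.
Context (G : zmodType).

(* Elements of infinite order get order 0. *)
Definition ord (g : G) : nat :=
  if pselect (exists n, (0 < n)%N && (g *+ n == 0)%R) is left exn
  then ex_minn exn else 0.

Fact mulrn_ord g : (g *+ ord g = 0)%R.
Proof.
rewrite /ord; case: pselect => [exn|_]; last by rewrite mulr0n.
by case: ex_minnP => n /andP[_ /eqP].
Qed.

Definition finite_exponent :=
  exists2 n, (0 < n)%N & forall g : G, (g *+ n = 0)%R.

Context (G0 : {fset G}).

Definition prod_ord2_seq : seq_over G0 :=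
  \prod_(g : G0) ([mset g]%mset : seq_over G0) ^+ (2 * ord (val g)).

Fact prod_ord2_zero_sum : prod_ord2_seq \in @zero_sum G G0.
Proof.
have [m1 mM] := zero_sum_closed G0.
apply: (big_ind (fun S : seq_over G0 => S \in @zero_sum G G0)) => // g _.
rewrite inE.
have -> n : sigma (([mset g]%mset : seq_over G0) ^+ n) =
    (val g *+ n)%R.
  elim: n => [|n IHn]; first by rewrite expg0 sigma1 mulr0n.
  by rewrite expgS sigmaM IHn mulrS /sigma enum_msetn big_seq1.
by rewrite mulnC mulrnA mulrn_ord mul0rn.
Qed.

Definition prod_ord2 : zero_sum_monoid G0 :=
  Sub prod_ord2_seq prod_ord2_zero_sum.

End Order.

Arguments finite_exponent : clear implicits.

Definition weak_transfer (H B : monoidType) (theta : H -> B) :=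
  [/\ theta 1 = 1 /\ {morph theta : a b / a * b},
      forall b, exists a, theta a = b,
      forall a, theta a = 1 <-> is_unit a &
      forall (a : H) (n : nat) (v : 'I_n -> B), (0 < n)%N ->
        (forall i, is_atom (v i)) -> theta a = \prod_(i < n) v i ->
        exists (u : 'I_n -> H) (tau : 'S_n),
          [/\ forall i, is_atom (u i),
              a = \prod_(i < n) u i &
              forall i, theta (u i) = v (tau i)]].

Definition transfer_Krull (H : monoidType) (G : zmodType) (G0 : {fset G}) :=
  unit_cancellative H /\
  exists theta : H -> zero_sum_monoid G0, weak_transfer theta.

(* Main.v *)
(* Let N be an exponent of G, and let w(S) be N times the cross number
   sum_(g in S) 1 / ord(g), an additive weight.  Everything is equivalent to
   w(A) = N for all atoms A of B(G0): this condition makes the length of S equal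
   to w(S) / N.

   An atom A has 1 as its only length, while A^N is a product both of N atoms
   and of w(A) atoms of the form g^ord(g); so hf(H) = 1 forces w(A) = N, after
   lifting A to H.

   If P^2, with P = prod g^ord(g), has a unique length, then lengths of zero-sum
   divisors of P^2 are unique and additive.  For T dividing P, writing
   T^2 = E U with E a product of elements g^ord(g) and U dividing P shows that
   the defect N l(T) - w(T) doubles from T to U.  Defects of divisors of P are
   bounded, hence all vanish; and every atom divides P. *)
Require Import Defs.
From HB Require Import structures.
From mathcomp Require Import all_boot ssralg fingroup perm.
From mathcomp Require Import finmap multiset.
From mathcomp Require Import boolp classical_sets.
From mathcomp Require Import zify.

Set Implicit Arguments.
Unset Strict Implicit.
Unset Printing Implicit Defensive.

(** * Products of [k] atoms and their relation to sets of lengths *)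

Section AtomProducts.
Local Open Scope group_scope.
Context (M : monoidType).
Implicit Types (a b u : M) (k l n : nat).

(** Unlike in [lengths], [k = 0] means the empty product [1], so that lengths add under
    multiplication without a case split on units. *)
Definition atom_product k a :=
  exists u : 'I_k -> M, (forall i, is_atom (u i)) /\ a = \prod_(i < k) u i.

Lemma is_unit1 : is_unit (1 : M).
Proof. by exists 1; rewrite mulg1. Qed.

Lemma atom_product0 : atom_product 0 1.
Proof. by exists (fun=> 1); split=> [[]|]; rewrite ?big_ord0. Qed.

Lemma atom_product1 u : is_atom u -> atom_product 1 u.
Proof. by move=> atom_u; exists (fun=> u); rewrite big_ord1. Qed.

Lemma atom_product0_inv a : atom_product 0 a -> a = 1.
Proof. by case=> u [_ ->]; rewrite big_ord0. Qed.

Lemma atom_productS_inv k a : atom_product k.+1 a ->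
  exists u b, [/\ is_atom u, atom_product k b & a = u * b].
Proof.
case=> u [atom_u ->]; exists (u ord0), (\prod_(i < k) u (lift ord0 i)).
by split=> //; [exists (fun i => u (lift ord0 i)) | rewrite big_ord_recl].
Qed.

Lemma atom_productM k l a b :
  atom_product k a -> atom_product l b -> atom_product (k + l) (a * b).
Proof.
move=> [u [atom_u ->]] [v [atom_v ->]].
exists (fun i => match split i with inl j => u j | inr j => v j end); split.
  by move=> i; case: (split i).
rewrite big_split_ord /=; congr (_ * _); apply: eq_bigr => i _.
  case: (splitP (lshift l i)) => j /= ij; first by congr u; apply: val_inj.
  by have := ltn_ord i; lia.
case: (splitP (rshift k i)) => j /= ij; first by have := ltn_ord j; lia.
by congr v; apply: val_inj => /=; lia.
Qed.

Lemma atom_productX k a n : atom_product k a -> atom_product (n * k) (a ^+ n).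
Proof.
move=> ka; elim: n => [|n IHn]; first exact: atom_product0.
by rewrite mulSn expgS; apply: atom_productM.
Qed.

Lemma lengthsE a k : ~ is_unit a -> lengths a k <-> atom_product k a.
Proof.
move=> nUa; split=> [[[/nUa]|[]] //|ka]; right; split=> //.
case: k ka => // /atom_product0_inv a1.
by case: nUa; rewrite a1; apply: is_unit1.
Qed.

Lemma lengths_unit a k : is_unit a -> lengths a k <-> k = 0.
Proof. by move=> Ua; split=> [[[]|[]] //|->]; left. Qed.

Lemma unique_length_eq a k l : unique_length a -> ~ is_unit a ->
  atom_product k a -> atom_product l a -> k = l.
Proof.
move=> [m am] nUa /(lengthsE _ nUa) + /(lengthsE _ nUa).
by rewrite am => -> ->.
Qed.

Lemma unique_length_lengths (N : monoidType) a (b : N) :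
  (forall k, lengths a k <-> lengths b k) ->
  unique_length a <-> unique_length b.
Proof.
move=> ab; rewrite /unique_length (_ : lengths a = lengths b) //.
by apply/seteqP; split=> k /ab.
Qed.

Lemma unique_lengthI a k : lengths a k -> (forall l, lengths a l -> l = k) ->
  unique_length a.
Proof.
by move=> ak akP; exists k; apply/seteqP; split=> l; [apply: akP | move=> ->].
Qed.

End AtomProducts.

(** * Units, atoms and lengths are the same in a divisor closure as in [M] *)

Section DivisorClosure.
Local Open Scope group_scope.
Context (M : monoidType) (a : M).
Notation D := (divisor_closure_monoid a).
Implicit Types (x y : D) (b c : M).

Lemma divisor_closure_mem : a \in divisor_closure a.
Proof. by apply/asboolP. Qed.

Lemma divisor_closure_factor b c d :
  b * c * d \in divisor_closure a -> c \in divisor_closure a.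
Proof.
move=> /asboolP abcd; apply/asboolP=> S subS divS Sa.
exact: divS (abcd S subS divS Sa) _.
Qed.

Lemma divisor_closureM b c : b * c \in divisor_closure a ->
  b \in divisor_closure a /\ c \in divisor_closure a.
Proof.
move=> abc; split.
  by apply: (@divisor_closure_factor 1 b c); rewrite mul1g.
by apply: (@divisor_closure_factor b c 1); rewrite mulg1.
Qed.

(** An inverse in [M] is a factor of [1], so it already lies in the divisor closure. *)
Lemma is_unit_val x : is_unit x <-> is_unit (val x).
Proof.
split=> [[y [xy yx]]|[b [xb bx]]].
  by exists (val y); rewrite -!valM xy yx val1.
have [|_ Db] := @divisor_closureM (val x) b.
  by rewrite xb; have := valP (1 : D); rewrite val1.
by exists (Sub b Db); split; apply: val_inj; rewrite valM SubK.
Qed.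

Lemma is_atom_val x : is_atom x <-> is_atom (val x).
Proof.
split=> -[nUx atom_x].
  split=> [/is_unit_val//|b c xbc].
  have [Db Dc] := @divisor_closureM b c ltac:(by rewrite -xbc; apply: valP).
  have [||] := atom_x (Sub b Db) (Sub c Dc).
  - by apply: val_inj; rewrite valM !SubK.
  - by move/is_unit_val; left.
  - by move/is_unit_val; right.
split=> [/is_unit_val//|y z xyz].
by have [|/is_unit_val|/is_unit_val] := atom_x (val y) (val z);
  [rewrite -valM xyz | left | right].
Qed.

Lemma atom_product_val k x : atom_product k x <-> atom_product k (val x).
Proof.
split.
  case=> u [atom_u ->]; exists (fun i => val (u i)); split=> [i|].
    exact/is_atom_val.
  by elim/big_rec2: _ => [|i b y _ <-]; rewrite ?val1 ?valM.
(* Conversely, atoms of [M] are split off one by one; being factors of [val x], they lie in the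
   closure. *)
elim: k x => [|k IHk] x.
  move=> /atom_product0_inv x1; rewrite (_ : x = 1); first exact: atom_product0.
  by apply: val_inj; rewrite val1.
move=> /atom_productS_inv[u [b [atom_u kb xub]]].
have [Du Db] := @divisor_closureM u b ltac:(by rewrite -xub; apply: valP).
have -> : x = (Sub u Du : D) * Sub b Db by apply: val_inj; rewrite valM !SubK.
rewrite -add1n; apply: atom_productM; last by apply: IHk; rewrite SubK.
by apply/atom_product1/is_atom_val; rewrite SubK.
Qed.

Lemma lengths_val x k : lengths x k <-> lengths (val x) k.
Proof.
have [Ux|nUx] := pselect (is_unit x).
  by rewrite !lengths_unit //; apply/is_unit_val.
by rewrite !lengthsE ?atom_product_val//; apply/is_unit_val.
Qed.

End DivisorClosure.

(** * The value 1 of the half-factoriality index *)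

Lemma half_factorial_hf (H : monoidType) : half_factorial H -> hf H = Some 1%N.
Proof.
move=> hfH; have hf1 : (0 < 1)%N && `[< hf_property H 1 >].
  apply/asboolP=> a _ x; have [k xk] := hfH (val x).
  by apply/(unique_length_lengths (lengths_val x)); exists k.
rewrite /hf; case: pselect => [exN|[]]; last by exists 1%N.
by case: ex_minnP => -[//|[//|n]] _ /(_ _ hf1).
Qed.

Lemma hf_eq1 (H : monoidType) : hf H = Some 1%N -> hf_property H 1.
Proof.
rewrite /hf; case: pselect => // exN; case: ex_minnP => n /andP[_ /asboolP hfn] _.
by case=> <-.
Qed.

(** * Lengths along a weak transfer homomorphism to a conical atomic monoid *)

Section WeakTransfer.
Local Open Scope group_scope.
Context (H B : monoidType) (theta : H -> B).
Hypothesis theta_transfer : weak_transfer theta.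
Hypothesis conicalB : forall x y : B, x * y = 1 -> x = 1.
Hypothesis atomicB : forall b : B, exists k, atom_product k b.

Let theta1 : theta 1 = 1. Proof. by case: theta_transfer => -[]. Qed.
Let thetaM : {morph theta : a b / a * b}.
Proof. by case: theta_transfer => -[]. Qed.

Lemma transfer_unit a : is_unit a <-> theta a = 1.
Proof. by case: theta_transfer => _ _ unitE _; rewrite unitE. Qed.

Lemma conical_unit (b : B) : is_unit b <-> b = 1.
Proof. by split=> [[c [/conicalB]]|->]; last exact: is_unit1. Qed.

(** For [k = 0] this would fail at units other than [1], which [theta] also sends to the empty
    product. *)
Lemma atom_product_lift k a :
  0 < k -> atom_product k (theta a) -> atom_product k a.
Proof.
move=> k0 [v [atom_v av]]; have [_ _ _ lift] := theta_transfer.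
by have [u [_ [atom_u au _]]] := lift _ _ _ k0 atom_v av; exists u.
Qed.

(** For an atom [a], some factorization of [theta a] into atoms lifts to [a], so it must consist of
    one atom. *)
Lemma transfer_atom a : is_atom a <-> is_atom (theta a).
Proof.
split=> [atom_a|/atom_product1/(atom_product_lift (ltn0Sn 0))]; last first.
  by case=> u [atom_u ->]; rewrite big_ord1.
have [[|[|k]] kv] := atomicB (theta a).
- by case: atom_a => nUa _; case: nUa; apply/transfer_unit/atom_product0_inv.
- by case: kv => v [atom_v ->]; rewrite big_ord1.
have [u [b [[nUu _] kb aub]]] := atom_productS_inv (atom_product_lift (ltn0Sn _) kv).
have [c [d [[nUc _] _ bcd]]] := atom_productS_inv kb.
(* If [b = c * d] is a unit, then [theta c * theta d = 1], and conicity of [B] makes [c] a unit,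
   against [c] being an atom. *)
have [_ /(_ _ _ aub)[//|/transfer_unit]] := atom_a.
by rewrite bcd thetaM => /conicalB/transfer_unit.
Qed.

Lemma atom_product_transfer k a : atom_product k a -> atom_product k (theta a).
Proof.
case=> u [atom_u ->]; exists (fun i => theta (u i)); split=> [i|].
  exact/transfer_atom.
by elim/big_rec2: _ => [|i b y _ <-].
Qed.

Lemma transfer_lengths a k : lengths a k <-> lengths (theta a) k.
Proof.
have [Ua|nUa] := pselect (is_unit a).
  by rewrite !lengths_unit //; apply/conical_unit/transfer_unit.
have nUta : ~ is_unit (theta a) by move/conical_unit/transfer_unit.
rewrite !lengthsE //; split; first exact: atom_product_transfer.
case: k => [/atom_product0_inv/transfer_unit//|k]; exact: atom_product_lift.
Qed.

Lemma transfer_half_factorial : half_factorial B -> half_factorial H.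
Proof. by move=> hfB a; apply/(unique_length_lengths (transfer_lengths a)). Qed.

(** A preimage [a] of [v] is an atom, so its only length is 1 and its divisor closure is
    half-factorial. There [a ^+ n] has length [n], and also length [k] by lifting from [v ^+ n]. *)
Lemma hf1_atom_power (v : B) n k : hf H = Some 1%N -> is_atom v -> 0 < n ->
  0 < k -> atom_product k (v ^+ n) -> k = n.
Proof.
move=> /hf_eq1 hfH atom_v n0 k0 kvn.
have [_ /(_ v)[a av] _ _] := theta_transfer.
have atom_a : is_atom a by apply/transfer_atom; rewrite av.
have nUa : ~ is_unit a by case: atom_a.
have Xa m : theta (a ^+ m) = v ^+ m.
  by elim: m => // m IHm; rewrite !expgS thetaM IHm av.
have /hfH hfa : unique_length (a ^+ 1).
  apply: (@unique_lengthI _ _ 1) => [|[|[|l]]].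
  - exact/(lengthsE _ nUa)/atom_product1.
  - move=> /(lengthsE _ nUa)/atom_product0_inv a1.
    by case: nUa; rewrite a1; apply: is_unit1.
  - by [].
  move=> /(lengthsE _ nUa)/atom_productS_inv[b [c [[nUb _] lc abc]]].
  have [d [e [[nUd _] _ cde]]] := atom_productS_inv lc.
  have [_ /(_ _ _ abc)[//|/transfer_unit]] := atom_a.
  by rewrite cde thetaM => /conicalB/transfer_unit.
pose x : divisor_closure_monoid a := Sub a (divisor_closure_mem a).
have valX m : val (x ^+ m) = a ^+ m.
  by elim: m => [|m IHm]; rewrite ?expg0 ?val1 // !expgS valM IHm SubK.
have nUxn : ~ is_unit (x ^+ n).
  rewrite is_unit_val valX transfer_unit Xa; case: n n0 {kvn} => // n _.
  by rewrite expgS => /conicalB/conical_unit; case: atom_v.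
apply: unique_length_eq (hfa (x ^+ n)) nUxn _ _.
  by apply/atom_product_val; rewrite valX; apply: atom_product_lift; rewrite ?Xa.
rewrite -[X in atom_product X _]muln1; apply/atom_productX/atom_product1.
by apply/is_atom_val; rewrite SubK.
Qed.

End WeakTransfer.

(** * Orders of group elements *)

Section Order.
Local Open Scope ring_scope.
Import GRing.Theory.
Context (G : zmodType).
Implicit Types (g : G) (n : nat).

Lemma ord_gt0 g n : (0 < n)%N -> g *+ n = 0 -> (0 < ord g)%N.
Proof.
move=> n0 gn; rewrite /ord; case: pselect => [exn|[]].
  by case: ex_minnP => m /andP[].
by exists n; rewrite n0 gn eqxx.
Qed.

Lemma ord_le g n : (0 < n)%N -> g *+ n = 0 -> (ord g <= n)%N.
Proof.
move=> n0 gn; rewrite /ord; case: pselect => // exn.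
by case: ex_minnP => m _ ->//; rewrite n0 gn eqxx.
Qed.

Lemma ord_dvdn g n : g *+ n = 0 -> (ord g %| n)%N.
Proof.
move=> gn; have [->|n0] := posnP n; first exact: dvdn0.
have o0 := ord_gt0 n0 gn.
have : g *+ (n %% ord g) = 0.
  rewrite -gn {2}(divn_eq n (ord g)) mulrnDr mulnC mulrnA mulrn_ord.
  by rewrite mul0rn add0r.
rewrite /dvdn; case: posnP => // r0 /(ord_le r0).
by rewrite leqNgt ltn_mod o0.
Qed.

End Order.

(** * Zero-sum sequences described by their multiplicities *)

Section ZeroSum.
Local Open Scope group_scope.
Import GRing.Theory.
Context (G : zmodType) (G0 : {fset G}).
Notation B := (zero_sum_monoid G0).
Implicit Types (S T U V A : B) (g h : G0).

Definition mult S g : nat := (val S : multiset G0) g.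

Lemma multP S T : mult S =1 mult T -> S = T.
Proof. by move=> ST; apply/val_inj/msetP. Qed.

Lemma mult1 g : mult 1 g = 0.
Proof. by rewrite /mult val1 mset0E. Qed.

Lemma multM S T g : mult (S * T) g = mult S g + mult T g.
Proof. by rewrite /mult valM msetE2. Qed.

Lemma multX S n g : mult (S ^+ n) g = (n * mult S g)%N.
Proof. by elim: n => [|n IHn]; rewrite ?mult1 // expgS multM IHn. Qed.

Lemma seq_over_prodE (F : G0 -> nat) h :
  (\prod_(g : G0) (([mset g]%mset : seq_over G0) ^+ F g) : multiset G0) h = F h.
Proof.
have appM : {morph (fun S : seq_over G0 => (S : multiset G0) h) :
    S T / S * T >-> S + T} by move=> S T; rewrite msetE2.
rewrite (big_morph _ appM (mset0E h)) (bigD1 h) //= big1 ?addn0 => [|g /negPf gh].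
  elim: (F h) => [|n IHn]; first by rewrite mset0E.
  by rewrite expgS appM IHn msetnxx.
elim: (F g) => [|n IHn]; first by rewrite mset0E.
by rewrite expgS appM IHn msetnE eq_sym gh.
Qed.

Lemma sigmaE (S : seq_over G0) :
  sigma S = (\sum_(g : G0) val g *+ (S : multiset G0) g)%R.
Proof.
rewrite /sigma (partition_big id predT) //=; apply: eq_bigr => g _.
rewrite (eq_bigr (fun=> val g)) => [|h /eqP-> //].
by rewrite big_const_seq count_mem_mset iter_addr_0.
Qed.

Lemma sum_mult S : (\sum_(g : G0) val g *+ mult S g = 0)%R.
Proof. by have := valP S; rewrite inE sigmaE => /eqP. Qed.

Lemma exists_mult (f : G0 -> nat) : (\sum_(g : G0) val g *+ f g = 0)%R ->
  exists S, mult S =1 f.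
Proof.
move=> f0; pose s : seq_over G0 :=
  \prod_(g : G0) ([mset g]%mset : seq_over G0) ^+ f g.
have s0 : s \in @zero_sum G G0.
  rewrite inE sigmaE -[X in _ == X]f0; apply/eqP/eq_bigr => g _.
  by rewrite seq_over_prodE.
by exists (Sub s s0) => g; rewrite /mult SubK seq_over_prodE.
Qed.

(** The complementary sequence has sum [0 - 0], so it is zero-sum too. *)
Lemma mult_dvd S T : (forall g, mult T g <= mult S g) -> exists U, S = T * U.
Proof.
move=> TS; have [|U UE] := @exists_mult (fun g => mult S g - mult T g)%N.
  under eq_bigr do rewrite mulrnBr //.
  by rewrite sumrB !sum_mult subr0.
by exists U; apply: multP => g; rewrite multM UE subnKC.
Qed.

Lemma zero_sum_conical S T : S * T = 1 -> S = 1.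
Proof.
move=> ST; apply: multP => g; have := mult1 g.
by rewrite -{1}ST multM mult1 => /eqP; rewrite addn_eq0 => /andP[/eqP].
Qed.

Lemma zero_sum_unit S : is_unit S <-> S = 1.
Proof. exact: (conical_unit (@zero_sum_conical)). Qed.

Lemma mult_prod_ord2 g : mult (prod_ord2 G0) g = (2 * ord (val g))%N.
Proof. exact: seq_over_prodE. Qed.

(** * Weights, powers [g^ord(g)], and the doubling of defects *)

Section FiniteExponent.
Context (N : nat).
Hypotheses (N_gt0 : 0 < N) (expN : forall x : G, (x *+ N = 0)%R).

Let o g := ord (val g).
Let o_gt0 g : 0 < o g. Proof. exact: ord_gt0 (expN _). Qed.
Let dvd_oN g : o g %| N. Proof. exact: ord_dvdn. Qed.

(* [N] times the cross number [\sum_g mult S g / ord g] of [S]. *)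
Definition weight S : nat := (\sum_(g : G0) mult S g * (N %/ ord (val g)))%N.

Lemma weight1 : weight 1 = 0.
Proof. by rewrite /weight big1 // => g _; rewrite mult1. Qed.

Lemma weightM S T : weight (S * T) = weight S + weight T.
Proof.
by rewrite /weight -big_split; apply: eq_bigr => g _; rewrite multM mulnDl.
Qed.

Lemma weight_eq0 S : weight S = 0 -> S = 1.
Proof.
move=> /eqP; rewrite sum_nat_eq0 => /forallP S0; apply: multP => g.
have := S0 g; rewrite mult1 muln_eq0 => /orP[/eqP//|].
by rewrite eqn0Ngt divn_gt0 ?o_gt0 // dvdn_leq ?dvd_oN.
Qed.

Lemma weight_gt0 S : ~ is_unit S -> 0 < weight S.
Proof. by rewrite lt0n => nUS; apply/eqP=> /weight_eq0/zero_sum_unit. Qed.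

(** Weight is additive and positive on non-units, so splitting into non-units terminates. *)
Lemma zero_sum_atomic S : exists k, atom_product k S.
Proof.
have [n] := ubnP (weight S); elim: n S => // n IHn S Sn.
have [/zero_sum_unit->|nUS] := pselect (is_unit S).
  by exists 0; apply: atom_product0.
have [/atom_product1|natomS] := pselect (is_atom S); first by exists 1%N.
have [T [U [STU nUT nUU]]] :
    exists T U, [/\ S = T * U, ~ is_unit T & ~ is_unit U].
  apply: contrapT => noTU; case: natomS; split=> // T U STU.
  apply: contrapT => /not_orP[nUT nUU]; apply: noTU.
  by exists T, U.
have := weight_gt0 nUT; have := weight_gt0 nUU.
move: Sn; rewrite STU weightM => Sn T0 U0.
have [|k kT] := IHn T; first lia.
have [|l lU] := IHn U; first lia.
by exists (k + l); apply: atom_productM.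
Qed.

Lemma atom_product_le_weight k S : atom_product k S -> k <= weight S.
Proof.
elim: k S => // k IHk S /atom_productS_inv[A [T [[nUA _] /IHk kT ->]]].
by have := weight_gt0 nUA; rewrite weightM; lia.
Qed.

Lemma half_factorial_of_weight :
  (forall A, is_atom A -> weight A = N) -> half_factorial B.
Proof.
move=> atomN; have prodN k S : atom_product k S -> weight S = (k * N)%N.
  elim: k S => [|k IHk] S; first by move/atom_product0_inv->; rewrite weight1.
  by move=> /atom_productS_inv[A [T [/atomN AN /IHk kT ->]]]; rewrite weightM AN kT.
move=> S; have [US|nUS] := pselect (is_unit S).
  by exists 0; apply/seteqP; split=> k /=; rewrite lengths_unit.
have [k kS] := zero_sum_atomic S; apply: (@unique_lengthI _ _ k).
  exact/lengthsE.
move=> l /lengthsE-/(_ nUS)/prodN; rewrite (prodN _ _ kS) => /eqP.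
by rewrite eqn_pmul2r // => /eqP.
Qed.

(** A factor of [g^ord(g)] is a power of [g]; if it is zero-sum and nonempty, its exponent is at
    least [ord(g)], which leaves nothing for the cofactor. *)
Lemma ord_power_atom g A :
  mult A =1 (fun h => if h == g then o g else 0) -> is_atom A.
Proof.
move=> AE; split=> [/zero_sum_unit A1|S T AST].
  by have := AE g; have := o_gt0 g; rewrite A1 mult1 eqxx; lia.
have STE h : h != g -> mult S h = 0 /\ mult T h = 0.
  by move=> /negPf hg; have := AE h; rewrite AST multM hg; lia.
have [S0|S0] := posnP (mult S g).
  left; apply/zero_sum_unit/multP => h; rewrite mult1.
  by have [->//|/STE[]] := eqVneq h g.
right; apply/zero_sum_unit/multP => h; rewrite mult1.
have [->|/STE[]//] := eqVneq h g.
have : o g <= mult S g.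
  apply: ord_le => //; have := sum_mult S.
  by rewrite (bigD1 g) //= big1 ?addr0 // => i /STE[-> _]; rewrite mulr0n.
by have := AE g; rewrite AST multM eqxx; lia.
Qed.

Lemma exists_ord_power g :
  exists A, mult A =1 (fun h => if h == g then o g else 0).
Proof.
apply: exists_mult; rewrite (bigD1 g) //= eqxx mulrn_ord add0r big1 // => h.
by move=> /negPf->; rewrite mulr0n.
Qed.

Lemma ord_power_product (e : G0 -> nat) S :
  (forall g, mult S g = (e g * o g)%N) -> atom_product (\sum_(g : G0) e g) S.
Proof.
move=> SE; have /choice[P PE] := exists_ord_power.
have -> : S = \prod_(g : G0) P g ^+ e g.
  apply: multP => h; rewrite SE.
  rewrite (big_morph (fun T => mult T h) (fun T U => multM T U h) (mult1 h)).
  rewrite (bigD1 h) //= big1 ?addn0 => [|g /negPf gh].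
    by rewrite multX PE eqxx.
  by rewrite multX PE eq_sym gh muln0.
apply: (big_ind2 (@atom_product B)) => [|????|g _].
- exact: atom_product0.
- exact: atom_productM.
rewrite -[X in atom_product X]muln1; apply/atom_productX/atom_product1.
exact: ord_power_atom (PE g).
Qed.

(** The exponent of [g] in [A ^+ N] is [mult A g * N], which amounts to [mult A g * (N / ord(g))]
    copies of the atom [g^ord(g)]. *)
Lemma atom_power_weight A : atom_product (weight A) (A ^+ N).
Proof.
apply: (@ord_power_product (fun g => mult A g * (N %/ o g)))%N => g.
by rewrite multX -mulnA divnK // mulnC.
Qed.

(** Otherwise [g^ord(g)] would be a proper divisor of [A]. Hence every atom divides the product of
    all [g^ord(g)]. *)
Lemma atom_mult_le A g : is_atom A -> mult A g <= o g.
Proof.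
move=> atom_A; rewrite leqNgt; apply/negP=> Ag.
have [P PE] := exists_ord_power g.
have [|U AU] := @mult_dvd A P.
  by move=> h; rewrite PE; case: eqP => // ->; apply: ltnW.
have [_ /(_ _ _ AU)[/zero_sum_unit|/zero_sum_unit] E] := atom_A.
  by have := PE g; rewrite E mult1 eqxx; have := o_gt0 g; lia.
by move: Ag; rewrite AU E mulg1 PE eqxx ltnn.
Qed.

(* The equation says [N * m - weight U = 2 * (N * l - weight T)], with the
   negative terms moved so that no truncated subtraction occurs. *)
Lemma defect_double T l : unique_length (prod_ord2 G0) ->
  (forall g, mult T g <= o g) -> atom_product l T ->
  exists U m, [/\ forall g, mult U g <= o g, atom_product m U &
    (N * m + 2 * weight T = weight U + 2 * (N * l))%N].
Proof.
move=> uniqP To lT.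
(* The boolean, read as 0 or 1, tells whether [g^ord(g)] divides [T * T]; removing it once leaves at
   most [o g] copies of [g]. *)
pose e g : nat := o g <= 2 * mult T g.
have [|E EE] := @exists_mult (fun g => e g * o g)%N.
  by rewrite big1 // => g _; rewrite mulnC mulrnA mulrn_ord mul0rn.
have [|U TU] := @mult_dvd (T * T) E.
  by move=> g; rewrite EE multM /e; case: leqP; lia.
have UE g : (mult T g + mult T g = e g * o g + mult U g)%N.
  by rewrite -multM TU multM EE.
have [m mU] := zero_sum_atomic U.
have [|V PV] := @mult_dvd (prod_ord2 G0) (T * T).
  by move=> g; rewrite mult_prod_ord2 multM; have := To g; rewrite /o; lia.
have [v vV] := zero_sum_atomic V.
have eE := ord_power_product EE.
(* Both sides are lengths of [prod_ord2 G0], factored as [T * T * V] and as [E * U * V]. The unit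
   case is separate: there all factors are [1] and all lengths 0. *)
have eqlen : l + l + v = \sum_g e g + m + v.
  have [/zero_sum_unit P1|nUP] := pselect (is_unit (prod_ord2 G0)).
    have prod1 k S R : S * R = 1 -> atom_product k S -> k = 0.
      move=> /zero_sum_conical-> /atom_product_le_weight.
      by rewrite weight1; lia.
    have TT1 : T * T * V = 1 by rewrite -PV.
    have EU1 : E * U * V = 1 by rewrite -TU.
    rewrite (prod1 _ _ _ TT1 (atom_productM lT lT)).
    by rewrite (prod1 _ _ _ EU1 (atom_productM eE mU)).
  apply: unique_length_eq uniqP nUP _ _; rewrite PV.
    by do 2!apply: atom_productM => //.
  by rewrite TU; do 2!apply: atom_productM => //.
exists U, m; split=> // [g|].
  by have := UE g; have := To g; rewrite /e; case: leqP; lia.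
have wE : weight E = (N * \sum_g e g)%N.
  rewrite /weight big_distrr; apply: eq_bigr => g _ /=.
  by rewrite EE -mulnA [(o g * _)%N]mulnC divnK ?dvd_oN // mulnC.
(* Subtract the weights in [T * T = E * U] from [N] times the lengths in [eqlen]: the contribution
   of [E] cancels, since each [g^ord(g)] has length 1 and weight [N]. *)
have := congr1 weight TU; rewrite !weightM wE; nia.
Qed.

Lemma defect_iter T l n : unique_length (prod_ord2 G0) ->
  (forall g, mult T g <= o g) -> atom_product l T ->
  exists U m, [/\ forall g, mult U g <= o g, atom_product m U &
    (N * m + 2 ^ n * weight T = weight U + 2 ^ n * (N * l))%N].
Proof.
move=> uniqP To lT; elim: n => [|n [U [m [Uo mU UE]]]].
  by exists T, l; split=> //; rewrite !mul1n addnC.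
have [V [k [Vo kV VE]]] := defect_double uniqP Uo mU.
by exists V, k; split=> //; rewrite expnS; nia.
Qed.

(** The defect [N - weight A] of an atom, doubled [n] times, is the defect of some [U] dividing the
    product of all [g^ord(g)], whatever [n] is. *)
Lemma atom_weight A : unique_length (prod_ord2 G0) -> is_atom A -> weight A = N.
Proof.
move=> uniqP atom_A.
pose M := (\sum_(g : G0) o g * (N %/ o g))%N.
(* Both [N * m] and [weight U] are at most [N * M], so the defect of [U] is too in absolute value.
   With [(N * M).+1] doublings the factor [2 ^ n] exceeds this bound, and a nonzero defect of [A] is
   impossible. *)
have [U [m [Uo mU UE]]] := defect_iter (N * M).+1 uniqP
  (fun g => atom_mult_le g atom_A) (atom_product1 atom_A).
have UM : weight U <= M by apply: leq_sum => g _; rewrite leq_mul2r Uo orbT.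
have mM : m <= M := leq_trans (atom_product_le_weight mU) UM.
have NM : N * m <= N * M by rewrite leq_mul2l mM orbT.
have MNM : M <= N * M by rewrite leq_pmull.
have := ltn_expl (N * M).+1 (isT : 1 < 2); move: UE; rewrite muln1.
by case: (ltngtP (weight A) N) => //; nia.
Qed.

End FiniteExponent.
End ZeroSum.

Theorem theorem1p1 (G : zmodType) (G0 : {fset G}) (H : monoidType) :
  finite_exponent G -> G0 <> fset0 -> transfer_Krull H G0 ->
  [<-> half_factorial H;
       hf H = Some 1%N;
       half_factorial (zero_sum_monoid G0);
       unique_length (prod_ord2 G0)].
Proof.
move=> [N N_gt0 expN] _ [_ [theta theta_transfer]].
have conicalB := @zero_sum_conical _ G0.
have atomicB := zero_sum_atomic (G0 := G0) N_gt0 expN.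
tfae.
- exact: half_factorial_hf.
- move=> hf1; apply: (half_factorial_of_weight N_gt0 expN) => A atom_A.
  (* Used with exponent [N] and length [weight A]. *)
  apply: (hf1_atom_power theta_transfer conicalB atomicB hf1 atom_A) => //.
    by apply: weight_gt0 expN _ _ => //; case: atom_A.
  exact: atom_power_weight.
- by move=> hfB; apply: hfB.
- move=> uniqP; apply: (transfer_half_factorial theta_transfer conicalB atomicB).
  by apply: (half_factorial_of_weight N_gt0 expN) => A; apply: atom_weight.
Qed.
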